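(* Let $G$ be an integer programming game with finite player set $M=\{1,\dots,m\}$ in which each player $p\in M$ solves $$\max_{x^p}\{\Pi^p(x^p;x^{-p}) := f^p(x^p)+g^p(x^p;x^{-p}) : x^p\in X^p\},$$ where $X^p=\{x^p\in\mathbb{R}^{n_p^c}\times\mathbb{Z}^{n_p^i} : A^px^p\le b^p\}$ with $A^p$ a rational matrix and $b^p$ a rational vector of appropriate dimensions, $f^p$ is a real-valued function of player $p$'s own strategy only, and $g^p$ is a real-valued function of the strategies of all players. Let $\delta>0$, and let $\hat G$ be the integer programming game with the same players and the same strategy sets in which each player $p\in M$ solves $$\max_{x^p}\{\hat\Pi^p(x^p;x^{-p}) := \hat f^p(x^p)+g^p(x^p;x^{-p}) : x^p\in X^p\},$$ where $\hat f^p$ is a $\delta$-absolute approximation of $f^p$ in $X^p$. Then: (i) every Nash equilibrium $\hat\sigma$ of $\hat G$ is a $2\delta$-equilibrium of $G$; (ii) for every $\delta_M\ge 0$, every $\delta_M$-equilibrium of $\hat G$ is a $(2\delta+\delta_M)$-equilibrium of $G$.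
   Context: An integer programming game is a simultaneous, non-cooperative game with complete information among a finite set $M=\{1,\dots,m\}$ of players, where each player $p$ solves the parametric problem $\max_{x^p}\{\Pi^p(x^p;x^{-p}) : x^p\in X^p\}$. Here $X^p=\{x^p\in\mathbb{R}^{n_p^c}\times\mathbb{Z}^{n_p^i}: A^px^p\le b^p\}$ is the strategy set of player $p$, $\Pi^p$ is its payoff function, and $x^{-p}=(x^1,\dots,x^{p-1},x^{p+1},\dots,x^m)$ is the vector of strategies of all players except $p$. Absolute approximation: given $f:\mathbb{X}\to\mathbb{R}$ and $\delta>0$, a function $\hat f:\mathbb{X}\to\mathbb{R}$ is a $\delta$-absolute approximation of $f$ if $|f(x)-\hat f(x)|\le\delta$ for all $x\in\mathbb{X}$. Strategies: an element $x^p\in X^p$ is a pure strategy of player $p$. A mixed strategy of player $p$ is a probability distribution $\sigma^p$ over $X^p$; $\Delta^p$ denotes the set of these. A profile of mixed strategies is $\sigma=(\sigma^1,\dots,\sigma^m)$ with $\sigma^p\in\Delta^p$ for each $p$, and $\sigma^{-p}$ denotes the profile of mixed strategies of all players except $p$. $\Pi^p(\sigma^p;\sigma^{-p})$ is the expected payoff of player $p$ when the players randomize independently according to $\sigma$, and $\Pi^p(\bar x^p;\sigma^{-p})$ is the expected payoff of player $p$ when $p$ plays the pure strategy $\bar x^p$ and the others play $\sigma^{-p}$; similarly for $\hat\Pi^p$. The expected payoffs involved, for both $\Pi^p$ and $\hat\Pi^p$, are understood to be well-defined and finite (the functions are measurable and integrable with respect to the distributions involved). Equilibria: for $\delta\ge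 0$, a profile of mixed strategies $\hat\sigma$ is a $\delta$-Nash equilibrium (or $\delta$-equilibrium) of a game with payoffs $\Pi^p$ if, for every player $p\in M$, $$\Pi^p(\hat\sigma^p;\hat\sigma^{-p})+\delta\ \ge\ \Pi^p(\bar x^p;\hat\sigma^{-p})\qquad\text{for all }\bar x^p\in X^p.$$ A Nash equilibrium is a $0$-Nash equilibrium. For $\hat G$, the same definition is used with $\hat\Pi^p$ in place of $\Pi^p$. *)

(* Defs.v *)
From HB Require Import structures.
From mathcomp Require Import all_boot all_order all_algebra.
From mathcomp Require Import all_classical all_reals all_analysis.
From mathcomp Require Import measurable_realfun.
Import Order.TTheory GRing.Theory Num.Theory.
Import numFieldNormedType.Exports.

Set Implicit Arguments.
Unset Strict Implicit.
Unset Printing Implicit Defensive.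

Local Open Scope classical_set_scope.
Local Open Scope ring_scope.

Section product_probability.
Context (I : finType) (d : I -> measure_display)
  (T : forall i, measurableType (d i)) (R : realType).

Definition cylinders : set (set (forall i, T i)) :=
  \bigcup_i preimage_set_system setT (fun x : forall i, T i => x i) measurable.

Definition product_space := g_sigma_algebraType cylinders.

Definition override i (tx : T i * product_space) : product_space :=
  dfwith tx.2 i tx.1.

Lemma measurable_coord i :
  measurable_fun setT (fun x : product_space => x i).
Proof.
by move=> _ A mA; apply: sub_sigma_algebra; exists i => //; exists A.
Qed.

Lemma measurable_override i : measurable_fun setT (@override i).
Proof.
apply: (@measurability _ _ (T i * product_space)%type product_space _ _
  cylinders) => // _ [_ [j _ [A mA <-]] <-].
have mj : measurable_fun setT (fun tx : T i * product_space => override tx j).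
  have [ij|ij] := eqVneq i j.
    subst j; rewrite (_ : (fun _ => _) = fst); first exact: measurable_fst.
    by apply/funext => tx; exact: dfwithin.
  rewrite (_ : (fun _ => _) = (fun x : product_space => x j) \o snd).
    by apply: measurableT_comp; [exact: measurable_coord|exact: measurable_snd].
  by apply/funext => tx; exact: dfwithout.
by have := mj measurableT A mA; rewrite !setTI.
Qed.

HB.instance Definition _ i := isMeasurableFun.Build _ _ _ _ (@override i)
  (@measurable_override i).

Variable P : forall i, probability (T i) R.

(* Draws the coordinates listed in s independently from the P i; the point at
   which the recursion starts is overwritten once s lists all of I. *)
Fixpoint draw (s : seq I) : probability product_space R :=
  if s is i :: s' then distribution (P i \x draw s')%E (@override i)
  else dirac (point : product_space).

Definition product_probability : probability product_space R := draw (enum I).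

Lemma measurable_box (s : seq I) (A : forall i, set (T i)) :
  (forall i, measurable (A i)) ->
  measurable [set x : product_space | forall i, i \in s -> A i (x i)].
Proof.
move=> mA; elim: s => [|i s ih].
  by rewrite (_ : mkset _ = setT) //; apply/seteqP; split.
rewrite (_ : mkset _ = ((fun x : product_space => x i) @^-1` A i) `&`
    [set x | forall j, j \in s -> A j (x j)]).
  apply: measurableI => //; rewrite -[X in measurable X]setTI.
  exact: measurable_coord.
apply/seteqP; split=> [x Ax|x [Aix Ax] j].
  by split=> [|j js]; apply: Ax; rewrite inE ?eqxx// js orbT.
by rewrite inE => /orP[/eqP ->|]; [exact: Aix|exact: Ax].
Qed.

Lemma product_probability_box (A : forall i, set (T i)) :
  (forall i, measurable (A i)) ->
  product_probability [set x | forall i, A i (x i)] = (\prod_i P i (A i))%E.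
Proof.
move=> mA.
have draw_box s : uniq s -> draw s [set x | forall i, i \in s -> A i (x i)] =
    (\prod_(i <- s) P i (A i))%E.
  elim: s => [_|i s ih /= /andP[nis us]].
    by rewrite big_nil (_ : mkset _ = setT) ?probability_setT//;
      apply/seteqP; split.
  rewrite big_cons -ih// /distribution /pushforward /=.
  rewrite -product_measure1E//; last exact: measurable_box.
  congr ((_ \x _)%E _); apply/seteqP; split=> -[t x] /=; last first.
    move=> [At Ax] j; have [ij _|ij] := eqVneq i j.
      by subst j; rewrite /override dfwithin.
    rewrite inE eq_sym (negPf ij)/= => js.
    by rewrite /override dfwithout//; exact: Ax.
  move=> Atx; split=> [|j js].
    by have := Atx i; rewrite /override dfwithin; apply; rewrite inE eqxx.
  have ij : i != j by apply: contraNneq nis => ->.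
  by have := Atx j; rewrite /override dfwithout//; apply; rewrite inE js orbT.
have := draw_box _ (enum_uniq I); rewrite big_enum /= => <-.
congr (draw _ _); apply/seteqP; split=> x Ax i //; apply: Ax.
exact: mem_enum.
Qed.

End product_probability.

Record strategy_data (m : nat) := StrategyData {
  dimc : 'I_m -> nat ;
  dimi : 'I_m -> nat ;
  nrow : 'I_m -> nat ;
  lhs : forall p, 'M[rat]_(nrow p, dimc p + dimi p) ;
  rhs : forall p, 'cV[rat]_(nrow p) }.

Section strategies.
Context (R : realType) (m : nat) (S : strategy_data m).

Definition ambient (p : 'I_m) :=
  g_sigma_algebraType (@open 'cV[R]_(dimc S p + dimi S p)).

(* The first dimc S p coordinates are the continuous ones, the last dimi S p
   the integer ones. *)
Definition strategy_set (p : 'I_m) : set (ambient p) :=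
  [set x : 'cV[R]_(dimc S p + dimi S p) |
     (forall j : 'I_(dimi S p), x (rshift (dimc S p) j) 0 \is a Num.int) /\
     (forall k : 'I_(nrow S p),
        (map_mx ratr (lhs S p) *m x) k 0 <= ratr (rhs S p k 0))].

Lemma measurable_entry p i :
  measurable_fun setT
    ((fun x : 'cV[R]_(dimc S p + dimi S p) => x i 0) : ambient p -> R).
Proof.
apply: (@measurability _ _ (ambient p) _ _ _ (@RGenOpens.G R)).
  exact: RGenOpens.measurableE.
move=> _ [_ [r [s ->]] <-]; rewrite setTI; apply: sub_sigma_algebra.
have : continuous (fun x : 'cV[R]_(dimc S p + dimi S p) => x i 0).
  exact: coord_continuous.
by move=> /continuousP; apply; exact: interval_open.
Qed.

Lemma measurable_strategy_set p : measurable (@strategy_set p).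
Proof.
have mint : measurable [set x : R | x \is a Num.int].
  rewrite (_ : mkset _ = \bigcup_n ([set n%:R] `|` [set - n%:R])).
    by apply: bigcupT_measurable => n; apply: measurableU;
      exact: measurable_set1.
  apply/seteqP; split=> x /=.
    rewrite intrE => /orP[|] /natrP[n xn]; exists n => //; [by left|right].
    by rewrite /= -xn opprK.
  by move=> [n _ [|] ->]; rewrite ?rpredN; exact: natr_int.
have rowE (x : 'cV[R]_(dimc S p + dimi S p)) k :
    (map_mx ratr (lhs S p) *m x) k 0 = \sum_i ratr (lhs S p k i) * x i 0.
  by rewrite mxE; apply: eq_bigr => i _; rewrite mxE.
have -> : @strategy_set p =
    (\bigcap_(j in [set: 'I_(dimi S p)])
      ((fun x : ambient p => x (rshift (dimc S p) j) 0) @^-1`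
        [set y : R | y \is a Num.int])) `&`
    (\bigcap_(k in [set: 'I_(nrow S p)])
      ((fun x : ambient p => \sum_i ratr (lhs S p k i) * x i 0) @^-1`
        `]-oo, ratr (rhs S p k 0)])).
  apply/seteqP; split=> x [xint xA]; split.
  - by move=> j _; exact: xint.
  - by move=> k _; rewrite /= in_itv/= -rowE; exact: xA.
  - by move=> j; exact: xint.
  - by move=> k; rewrite rowE; have := xA k I; rewrite /= in_itv.
apply: measurableI; apply: fin_bigcap_measurable => [|i _].
- exact: finite_finset.
- by rewrite -[X in measurable X]setTI; exact: measurable_entry.
- exact: finite_finset.
rewrite -[X in measurable X]setTI.
suff : measurable_fun setT
    (fun x : ambient p => \sum_j ratr (lhs S p i j) * x j 0 : R).
  by apply; [exact: measurableT|exact: measurable_itv].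
apply: measurable_sum => j; apply: measurable_funM => //.
exact: measurable_entry.
Qed.

Definition profile := product_space ambient.

Definition feasible : set profile := [set x | forall p, strategy_set (x p)].

(* A Borel distribution on the ambient space carried by the strategy set. *)
Record mixed_strategy (p : 'I_m) := MixedStrategy {
  mixed_law :> probability (ambient p) R ;
  mixed_supp : mixed_law (@strategy_set p) = 1%E }.

Definition mixed_profile := forall p, mixed_strategy p.

Lemma dirac_supp p (x : ambient p) : strategy_set x ->
  (dirac x : probability (ambient p) R) (@strategy_set p) = 1%E.
Proof. by move=> Sx; rewrite /= diracE mem_set. Qed.

(* A pure strategy is identified with the point mass at it. *)
Definition pure_strategy p (x : ambient p) (Sx : strategy_set x) :=
  MixedStrategy (dirac_supp Sx).

Definition joint_law (sigma : mixed_profile) : probability profile R :=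
  product_probability (fun p => mixed_law (sigma p)).

End strategies.

Arguments feasible R {m} S _.

(* A payoff is given on the whole ambient product, but only its values on
   feasible profiles matter below. *)
Record ipg (R : realType) (m : nat) := IPG {
  ipg_data :> strategy_data m ;
  payoff : 'I_m -> profile R ipg_data -> R }.

Section equilibria.
Context (R : realType) (m : nat) (G : ipg R m).

Definition payoff_integrable p (sigma : mixed_profile R G) :=
  (joint_law sigma).-integrable (feasible R G) (EFin \o payoff p).

(* Finite, hence meaningful, when payoff_integrable p sigma holds. *)
Definition expected_payoff p (sigma : mixed_profile R G) : R :=
  \int[joint_law sigma]_(x in feasible R G) payoff p x.

Definition deviation (sigma : mixed_profile R G) p (x : ambient R G p)
    (Sx : strategy_set x) : mixed_profile R G :=
  dfwith sigma p (pure_strategy Sx).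

Definition payoffs_well_defined (sigma : mixed_profile R G) :=
  forall p, payoff_integrable p sigma /\
    forall (x : ambient R G p) (Sx : strategy_set x),
      payoff_integrable p (deviation sigma Sx).

Definition delta_nash_equilibrium (delta : R) (sigma : mixed_profile R G) :=
  forall p (x : ambient R G p) (Sx : strategy_set x),
    expected_payoff p sigma + delta >= expected_payoff p (deviation sigma Sx).

Definition nash_equilibrium := delta_nash_equilibrium 0.

End equilibria.

Arguments payoff_integrable {R m} G p sigma.
Arguments expected_payoff {R m} G p sigma.
Arguments payoffs_well_defined {R m} G sigma.
Arguments delta_nash_equilibrium {R m} G delta sigma.
Arguments nash_equilibrium {R m} G sigma.

Definition absolute_approximation (R : realType) (X : Type) (D : set X)
    (delta : R) (f f' : X -> R) :=
  forall x, D x -> `|f x - f' x| <= delta.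

(* Main.v *)
(** Replacing f by fhat moves every expected payoff by at most delta, because
    the joint law gives mass at most 1 to the feasible profiles; this costs
    delta once at the equilibrium and once at the deviation. *)

Require Import Defs.
From mathcomp Require Import all_boot all_order all_algebra.
From mathcomp Require Import all_classical all_reals all_analysis.
From mathcomp Require Import lra.
Import Order.TTheory GRing.Theory Num.Theory.
Import numFieldNormedType.Exports.
Local Open Scope classical_set_scope.
Local Open Scope ring_scope.

(** Feasibility is a box condition with measurable sides over the finite list of all players. *)
Lemma measurable_feasible (R : realType) (m : nat) (S : strategy_data m) :
  measurable (feasible R S).
Proof.
have := @measurable_box _ _ _ (enum 'I_m) (@strategy_set R m S)
  (@measurable_strategy_set R m S).
congr (measurable _); apply/seteqP; split=> x Sx p //; apply: Sx.
exact: mem_enum.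
Qed.

(** The constant [delta] integrates over [D] to [delta] times the mass of [D], which is at most
    [delta] since [0 <= delta] and [mu] is a probability. *)
Lemma le_Rintegral_shift (d : measure_display) (T : measurableType d)
    (R : realType) (mu : probability T R) (D : set T) (delta : R)
    (u v : T -> R) :
  measurable D -> 0 <= delta ->
  mu.-integrable D (EFin \o u) -> mu.-integrable D (EFin \o v) ->
  (forall x, D x -> u x <= v x + delta) ->
  \int[mu]_(x in D) u x <= \int[mu]_(x in D) v x + delta.
Proof.
move=> mD delta0 iu iv uv.
have ic : mu.-integrable D (EFin \o cst delta).
  exact: finite_measure_integrable_cst.
have ivc : mu.-integrable D (EFin \o (fun x => v x + delta)).
  exact: (integrableD mD iv ic).
apply: (le_trans (le_Rintegral mD iu ivc uv)).
rewrite (RintegralD mD iv ic) lerD2l Rintegral_cst// ler_piMr//.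
by rewrite -lee_fin fineK ?fin_num_measure// probability_le1.
Qed.

(** The joint law depends on [S] and [sigma] only, so both games integrate against the same measure.
    Keeping [u] and [v] arbitrary lets either game take either role. *)
Lemma expected_payoff_shift (R : realType) (m : nat) (S : strategy_data m)
    (u v : 'I_m -> profile R S -> R) (delta : R) (p : 'I_m)
    (sigma : mixed_profile R S) :
  0 <= delta ->
  payoff_integrable (IPG u) p sigma -> payoff_integrable (IPG v) p sigma ->
  (forall x, feasible R S x -> u p x <= v p x + delta) ->
  expected_payoff (IPG u) p sigma <= expected_payoff (IPG v) p sigma + delta.
Proof.
by move=> *; apply: le_Rintegral_shift => //; exact: measurable_feasible.
Qed.

Theorem proposition1 (R : realType) (m : nat) (S : strategy_data m)
    (f fhat : forall p : 'I_m, ambient R S p -> R)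
    (g : 'I_m -> profile R S -> R) (delta : R) :
  0 < delta ->
  (forall p, absolute_approximation (@strategy_set R m S p) delta
               (f p) (fhat p)) ->
  let G := IPG (fun p (x : profile R S) => f p (x p) + g p x) in
  let Ghat := IPG (fun p (x : profile R S) => fhat p (x p) + g p x) in
  (forall sigma : mixed_profile R S,
     payoffs_well_defined G sigma -> payoffs_well_defined Ghat sigma ->
     nash_equilibrium Ghat sigma ->
     delta_nash_equilibrium G (2 * delta) sigma) /\
  (forall deltaM : R, 0 <= deltaM -> forall sigma : mixed_profile R S,
     payoffs_well_defined G sigma -> payoffs_well_defined Ghat sigma ->
     delta_nash_equilibrium Ghat deltaM sigma ->
     delta_nash_equilibrium G (2 * delta + deltaM) sigma).
Proof.
move=> delta0 fhatP G Ghat.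
have le_hat sigma p : payoff_integrable G p sigma ->
    payoff_integrable Ghat p sigma ->
    expected_payoff G p sigma <= expected_payoff Ghat p sigma + delta.
  move=> iG iGhat; apply: expected_payoff_shift => //; first exact: ltW.
  (* The term [g p x] cancels; the upper half of the absolute value bound remains. *)
  move=> x Sx; have := fhatP p _ (Sx p).
  by rewrite ler_norml => /andP[_]; lra.
have hat_le sigma p : payoff_integrable G p sigma ->
    payoff_integrable Ghat p sigma ->
    expected_payoff Ghat p sigma <= expected_payoff G p sigma + delta.
  move=> iG iGhat; apply: expected_payoff_shift => //; first exact: ltW.
  move=> x Sx; have := fhatP p _ (Sx p).
  by rewrite ler_norml => /andP[+ _]; lra.
(* Chain: from [G] to [Ghat] at the deviation, the equilibrium inequality in [Ghat], then back to
   [G] at [sigma]. *)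
have transfer deltaM sigma : payoffs_well_defined G sigma ->
    payoffs_well_defined Ghat sigma ->
    delta_nash_equilibrium Ghat deltaM sigma ->
    delta_nash_equilibrium G (2 * delta + deltaM) sigma.
  move=> wG wGhat eq p x Sx.
  have [iG iGdev] := wG p; have [iGhat iGhatdev] := wGhat p.
  have := le_hat _ _ (iGdev x Sx) (iGhatdev x Sx).
  have := eq p x Sx; have := hat_le _ _ iG iGhat.
  (* [deviation] carries the game as an implicit argument; unfolding it exposes the same profile for
     [G] and [Ghat]. *)
  by rewrite /deviation; lra.
split=> [sigma wG wGhat eq|deltaM _ sigma]; last exact: transfer.
(* Part (i) is the case [deltaM = 0]. *)
by rewrite -[2 * delta]addr0; exact: transfer.
Qed.
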